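(* Let $\lambda$ be a partition. Then the sequence $\{E_m(\lambda)\}_{m=0}^{\infty}$ uniquely determines $\lambda$; that is, if $\lambda,\lambda'$ are partitions with $E_m(\lambda)=E_m(\lambda')$ for all $m\ge0$, then $\lambda=\lambda'$.
   Context: Partitions are identified with Young diagrams; cell $(i,j)$ (row $i$, column $j$) lies in $\lambda$ iff $j\le\lambda_i$. $h_{i,j}$ denotes the hook length of cell $(i,j)$ in $\lambda$. For a partition $\mu$ with $\mu_i\le\lambda_i$ for all $i$, place a pebble in each cell of $\mu$ inside $\lambda$. A local excitation move moves a pebble from $(i,j)$ to $(i+1,j+1)$ provided the cells $(i,j+1)$, $(i+1,j)$, $(i+1,j+1)$ are all unoccupied and $(i+1,j+1)$ lies in $\lambda$. An excited diagram of $\mu$ in $\lambda$ is the set of cells occupied by pebbles after some finite sequence (possibly empty) of local excitation moves; $\mathcal{E}_\mu(\lambda)$ is the set of these. The excitation factor is $E_\mu(\lambda)=\sum_{\varepsilon\in\mathcal{E}_\mu(\lambda)}\prod_{(i,j)\in\varepsilon}h_{i,j}$, and $E_m(\lambda):=E_{[m]}(\lambda)$ for the one-row partition $[m]$; by convention $E_0(\lambda)=1$ and $E_m(\lambda)=0$ if $m>\lambda_1$. *)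

(* Defs.v *)
From HB Require Import structures.
From mathcomp Require Import all_boot.

Set Implicit Arguments.
Unset Strict Implicit.
Unset Printing Implicit Defensive.

Record intpart := Intpart {
  parts :> seq nat;
  _ : sorted geq parts && (0 \notin parts)
}.

HB.instance Definition _ := [isSub for parts].
HB.instance Definition _ := [Equality of intpart by <:].

(* Rows and columns are numbered from 0, and parts beyond the last are 0. *)
Definition part (la : intpart) (i : nat) : nat := nth 0 la i.

Lemma row_partition_subproof (m : nat) :
  sorted geq (nseq (0 < m) m) && (0 \notin nseq (0 < m) m).
Proof. by case: m. Qed.

(* [m], which is the empty partition when m = 0. *)
Definition row_partition (m : nat) : intpart :=
  Intpart (row_partition_subproof m).

Section Excitation.

Variable la : intpart.

(* The bounding box of la; it may contain positions outside la. *)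
Definition cell : finType := ('I_(size la) * 'I_(part la 0))%type.

Definition diagram : {set cell} := [set c : cell | c.2 < part la c.1].

(* The hook of c is c itself, its arm and its leg. *)
Definition hook (c : cell) : {set cell} :=
  [set d in diagram | ((d.1 == c.1) && (c.2 <= d.2))
                   || ((d.2 == c.2) && (c.1 <= d.1))].

Definition hook_length (c : cell) : nat := #|hook c|.

(* A pebble moves from c = (i, j) to d = (i + 1, j + 1); the positions
   (c.1, d.2) and (d.1, c.2) are then (i, j + 1) and (i + 1, j). *)
Definition excitation_move : rel {set cell} := fun D D' =>
  [exists c in D, exists d in diagram,
    [&& (d.1 == c.1.+1 :> nat) && (d.2 == c.2.+1 :> nat),
        [&& (c.1, d.2) \notin D, (d.1, c.2) \notin D & d \notin D]
      & D' == d |: (D :\ c)]].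

Variable mu : intpart.

Definition subpartition : bool :=
  [forall i : 'I_(size mu), part mu i <= part la i].

Definition initial_diagram : {set cell} :=
  [set c : cell | c.2 < part mu c.1].

(* Meaningful only when mu is a subpartition of la. *)
Definition excited_diagrams : {set {set cell}} :=
  [set D | connect excitation_move initial_diagram D].

Definition excitation_factor : nat :=
  \sum_(D in excited_diagrams) \prod_(c in D) hook_length c.

End Excitation.

Definition E (m : nat) (la : intpart) : nat :=
  if subpartition la (row_partition m)
  then excitation_factor la (row_partition m) else 0.

Lemma subpartition_row (m : nat) (la : intpart) :
  subpartition la (row_partition m) = (m <= part la 0).
Proof.
rewrite /subpartition /part; case: m => [|m].
  by apply/forallP=> -[].
apply/forallP/idP => [/(_ ord0) //|le_m [[|i] lt_i] //].
Qed.

Lemma E_gt (m : nat) (la : intpart) : part la 0 < m -> E m la = 0.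
Proof. by move=> lt_m; rewrite /E subpartition_row leqNgt lt_m. Qed.

Lemma E_0 (la : intpart) : E 0 la = 1.
Proof.
rewrite /E subpartition_row /= /excitation_factor.
have init0 : initial_diagram la (row_partition 0) = set0.
  by apply/setP=> c; rewrite !inE /part /= nth_nil ltn0.
suff -> : excited_diagrams la (row_partition 0) = [set set0].
  by rewrite big_set1 big_set0.
apply/setP=> D; rewrite !inE init0; apply/idP/eqP => [|->]; last exact: connect0.
case/connectP=> [[|D1 p]] /=; first by move=> _ ->.
by case/andP=> /exists_inP[c]; rewrite inE.
Qed.

(* Main.v *)
Require Import Defs.
From mathcomp Require Import all_boot.
From mathcomp Require Import all_order all_algebra.
From mathcomp Require Import ring zify.

Set Implicit Arguments.
Unset Strict Implicit.
Unset Printing Implicit Defensive.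

(* An excited diagram of [m] is determined by the m columns it meets, the pebble
   of a chosen column j lying in the row that counts the columns skipped before
   j. So E_m is a sum over lattice paths with steps (i, j) -> (i, j + 1),
   weighted by the hook length h(i, j), and (i, j) -> (i + 1, j + 1), weighted
   by 1. Dividing each hook length by u + i - j gives the generating function
   sum_m E_m / (u (u - 1) ... (u - m + 1)), and the sum over the paths that
   start at (i, j) has the closed form
   prod_(i <= t < la'_j) (u + t + 1 - j) / (u + t + 1 - la_t),
   with la' the conjugate of la: both sides satisfy the same recurrence along
   the first step. At (0, 0) the poles recover the la_t. *)

(** * The conjugate partition [colen] and the hook lengths *)

Definition colen (la : intpart) (c : nat) : nat := count (ltn c) la.

Lemma part_gt (la : intpart) i c : (c < part la i) = (i < colen la c).
Proof.
rewrite /part /colen; case: la => s /= /andP[sorted_s _].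
elim: s i sorted_s => [|x s IHs] [|i] //= sorted_s.
  have := order_path_min (rev_trans leq_trans) sorted_s.
  case: (ltnP c x) => //= le_xc /allP le_s; symmetry; apply/negbTE.
  rewrite -leqNgt leqn0 eqn0Ngt -has_count; apply/hasPn => y /le_s /= le_yx.
  by rewrite -leqNgt (leq_trans le_yx).
rewrite IHs ?(path_sorted sorted_s) //.
case: (ltnP c x) => //= le_xc; rewrite add0n.
have -> // : count (ltn c) s = 0.
apply/eqP; rewrite eqn0Ngt -has_count; apply/hasPn => y.
move/(allP (order_path_min (rev_trans leq_trans) sorted_s)) => /= le_yx.
by rewrite -leqNgt (leq_trans le_yx).
Qed.

Lemma part_mono (la : intpart) i j : i <= j -> part la j <= part la i.
Proof.
move=> le_ij; rewrite leqNgt part_gt -leqNgt.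
apply: leq_trans le_ij; by rewrite leqNgt -part_gt ltnn.
Qed.

Lemma size_colen (la : intpart) : size la = colen la 0.
Proof.
rewrite /colen; case: la => s /= /andP[_ s0]; symmetry; apply/eqP.
rewrite -all_count; apply/allP => x s_x /=; rewrite lt0n.
by apply: contraNneq s0 => <-.
Qed.

Lemma eq_part (la la' : intpart) : part la =1 part la' -> la = la'.
Proof.
move=> eq_la; apply/val_inj/(@eq_from_nth _ 0) => [|i _]; last exact: eq_la.
rewrite !size_colen; apply/eqP; rewrite eqn_leq !(leqNgt (colen _ _)).
by rewrite -!part_gt eq_la part_gt ltnn -eq_la part_gt ltnn.
Qed.

(* The subtractions are truncated: the value is 0 exactly outside la. *)
Definition hooklen (la : intpart) (i c : nat) : nat :=
  (part la i - c) + (colen la c - i.+1).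

Lemma hooklen_out (la : intpart) i c : part la i <= c -> hooklen la i c = 0.
Proof.
move=> le_c; rewrite /hooklen.
have : colen la c <= i by rewrite leqNgt -part_gt -leqNgt.
lia.
Qed.

Lemma card_ord_interval n a b : b <= n -> #|[set x : 'I_n | a <= x < b]| = b - a.
Proof.
move=> le_bn; rewrite cardsE -sum1_card -[RHS]muln1 -sum_nat_const_nat.
rewrite (big_nat_widen _ _ _ _ _ le_bn) (big_nat_widenl _ 0) // big_mkord.
by apply: eq_bigl => x; rewrite /in_mem /= andbC.
Qed.

Lemma hook_lengthE (la : intpart) (c : cell la) :
  c \in diagram la -> hook_length c = hooklen la c.1 c.2.
Proof.
rewrite inE => la_c; rewrite /hook_length /hooklen.
(* The corner [c] is counted with the arm and left out of the leg, so the two rectangles are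
   disjoint. *)
have -> : hook c =
    setX [set c.1] [set b : 'I_(part la 0) | c.2 <= b < part la c.1]
    :|: setX [set a : 'I_(size la) | c.1 < a < colen la c.2] [set c.2].
  apply/setP=> [[a b]]; rewrite !inE /=.
  case: (eqVneq a c.1) => [->|ne_a] /=.
    rewrite ltnn /= leqnn !andbT; case: eqP => [->|_]; first by rewrite leqnn la_c.
    by rewrite !orbF andbC.
  case: (eqVneq b c.2) => [->|_]; last by rewrite !andbF.
  by rewrite -part_gt !andbT andbC [c.1 < a]ltn_neqAle eq_sym ne_a.
rewrite cardsU disjoint_setI0 ?cards0 ?subn0; last first.
  rewrite disjoint_subset; apply/subsetP=> [[a b]]; rewrite !inE /=.
  by case/andP=> /eqP-> _; rewrite ltnn.
rewrite !cardsX !cards1 mul1n muln1 !card_ord_interval //.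
  exact: count_size.
exact: part_mono.
Qed.

(** * Column words: [b] marks the columns that carry a pebble *)

Definition skips (b : nat -> bool) (j : nat) : nat := \sum_(x < j) ~~ b x.

Lemma skips0 b : skips b 0 = 0.
Proof. exact: big_ord0. Qed.

Lemma skipsS b j : skips b j.+1 = skips b j + ~~ b j.
Proof. by rewrite /skips big_ord_recr. Qed.

Lemma skips_le b j : skips b j <= j.
Proof. by elim: j => [|j IHj]; rewrite ?skips0 // skipsS; case: (b j); lia. Qed.

Lemma eq_skips b b' : b =1 b' -> skips b =1 skips b'.
Proof. by move=> eq_b j; apply: eq_bigr => x _; rewrite eq_b. Qed.

Lemma skips_ltn m j : skips (fun x => x < m) j = j - m.
Proof. by elim: j => [|j IHj]; rewrite ?skips0 // skipsS IHj; lia. Qed.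

Lemma skips_cons a s j :
  skips (nth false (a :: s)) j.+1 = ~~ a + skips (nth false s) j.
Proof. by rewrite /skips big_ord_recl. Qed.

(** The effect on column words of exciting the pebble of column [j], meant for [b j] and
    [~~ b j.+1]; [unshift_bit] undoes such a move. *)
Definition shift_bit (b : nat -> bool) (j x : nat) : bool :=
  if x == j then false else if x == j.+1 then true else b x.

Definition unshift_bit (b : nat -> bool) (j x : nat) : bool :=
  if x == j then true else if x == j.+1 then false else b x.

Lemma unshift_bitK (b : nat -> bool) j : ~~ b j -> b j.+1 -> shift_bit (unshift_bit b j) j =1 b.
Proof.
move=> bj bj1 x; rewrite /shift_bit /unshift_bit.
by case: eqVneq => [->|_]; [rewrite (negbTE bj) | case: eqVneq => // ->].
Qed.

(** Exchanging the bits at [j] and [j.+1] alters no prefix count except the one that ends between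
    them. Hence only the moved pebble changes row, going down by one. *)
Lemma skips_shift (b : nat -> bool) j x : b j -> ~~ b j.+1 ->
  skips (shift_bit b j) x = skips b x + (x == j.+1).
Proof.
move=> bj /negbTE bj1; elim: x => [|x IHx]; first by rewrite !skips0.
rewrite !skipsS IHx /shift_bit; case: (eqVneq x j) => [->|ne_xj].
  by rewrite bj eqxx; case: eqVneq => //=; lia.
case: (eqVneq x j.+1) => [->|ne_xj1]; first by rewrite bj1; case: eqVneq => //=; lia.
by rewrite eqSS (negbTE ne_xj); lia.
Qed.

(** * Excited diagrams of a one-row partition as column words *)

Section Excited.

Variable la : intpart.
Local Notation n := (part la 0).

Definition placed (b : nat -> bool) : {set cell la} :=
  [set c : cell la | b c.2 && (c.1 == skips b c.2 :> nat)].

(** The condition that singles out the words of excited diagrams: every pebble lies in [la]. *)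
Definition fits (b : nat -> bool) : Prop :=
  forall j, b j -> j < part la (skips b j).

Lemma eq_placed b b' : b =1 b' -> placed b = placed b'.
Proof. by move=> eq_b; apply/setP=> c; rewrite !inE (eq_skips eq_b) eq_b. Qed.

Lemma eq_fits b b' : b =1 b' -> fits b -> fits b'.
Proof. by move=> eq_b fits_b j; rewrite -eq_b -(eq_skips eq_b); apply: fits_b. Qed.

Lemma fits_lt b j : fits b -> b j -> j < n.
Proof. by move=> fits_b /fits_b /leq_trans; apply; apply: part_mono. Qed.

Lemma part_size i c : c < part la i -> i < size la.
Proof. by rewrite part_gt => /leq_trans; apply; apply: count_size. Qed.

Lemma fits_cell b j : fits b -> b j ->
  exists2 c : cell la, c \in placed b & c.1 = skips b j :> nat /\ c.2 = j :> nat.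
Proof.
move=> fits_b bj.
exists (Ordinal (part_size (fits_b j bj)), Ordinal (fits_lt fits_b bj)) => //.
by rewrite inE /= bj eqxx.
Qed.

(** Since the words fit, each chosen column has its pebble inside the bounding box, so the columns
    met by the diagram give back the word. *)
Lemma placed_inj b b' : fits b -> fits b' -> placed b = placed b' -> b =1 b'.
Proof.
have sub b1 b2 : fits b1 -> placed b1 = placed b2 -> forall j, b1 j -> b2 j.
  move=> fits_b1 eq_b j b1j; case: (fits_cell fits_b1 b1j) => c.
  by rewrite eq_b inE => /andP[b2c _] [_ <-].
by move=> fb fb' eq_b j; apply/idP/idP; apply: sub.
Qed.

Lemma initial_placed m :
  initial_diagram la (row_partition m) = placed (fun x => x < m).
Proof.
apply/setP=> c; rewrite !inE skips_ltn /part /=.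
case: m => [|m] /=; first by rewrite nth_nil.
by case: c => [[[|i] lt_i] j] /=; rewrite ?nth_nil; lia.
Qed.

Lemma fits_ltn m : m <= n -> fits (fun x => x < m).
Proof.
move=> le_m j lt_j; rewrite skips_ltn.
by have -> : j - m = 0 by [lia]; apply: leq_trans le_m.
Qed.

Lemma placed_shift (b : nat -> bool) (c d : cell la) :
    d.1 = c.1.+1 :> nat -> d.2 = c.2.+1 :> nat ->
    c \in placed b -> ~~ b c.2.+1 ->
  placed (shift_bit b c.2) = d |: placed b :\ c.
Proof.
move=> d1 d2; rewrite inE => /andP[bc /eqP c1] bc1.
apply/setP=> -[x y]; rewrite !inE /= skips_shift // /shift_bit.
have pairE (e : cell la) : ((x, y) == e) = (x == e.1 :> nat) && (y == e.2 :> nat).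
  by case: e.
rewrite !pairE d1 d2 c1.
case: (eqVneq (y : nat) c.2) => [->|ne_y].
  by rewrite bc /=; case: eqP; case: eqP => //; lia.
case: (eqVneq (y : nat) c.2.+1) => [->|ne_y1] /=.
  by rewrite (negbTE bc1) /= andbF orbF andbT skipsS bc addn0 addn1.
by rewrite !andbF /= addn0.
Qed.

Lemma fits_shift (b : nat -> bool) j : fits b -> b j -> ~~ b j.+1 ->
  j.+1 < part la (skips b j).+1 -> fits (shift_bit b j).
Proof.
move=> fits_b bj bj1 lt_j x; rewrite skips_shift // /shift_bit.
case: eqVneq => // ne_xj; case: (eqVneq x j.+1) => [->|_] bx.
  by rewrite skipsS bj addn0 addn1.
by rewrite addn0; apply: fits_b.
Qed.

Lemma excitation_step b D : fits b -> excitation_move (placed b) D ->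
  exists b', [/\ fits b', skips b' n = skips b n & D = placed b'].
Proof.
move=> fits_b /exists_inP[c Dc /exists_inP[d la_d]].
case/andP=> /andP[/eqP d1 /eqP d2] /andP[/and3P[Dcd _ _] /eqP->].
have := Dc; rewrite inE => /andP[bc /eqP c1].
(* A pebble in the next column would stand in the same row [c.1], on a position that the move
   requires to be empty. *)
have bc1 : ~~ b c.2.+1.
  by apply: contra Dcd => bc1; rewrite inE /= d2 bc1 skipsS bc addn0 c1 eqxx.
exists (shift_bit b c.2); split; last by rewrite (placed_shift d1 d2).
  by apply: fits_shift => //; rewrite -c1 -d1 -d2; rewrite inE in la_d.
(* The column [d.2] lies in the bounding box, hence differs from [n], and the total count is
   unchanged. *)
rewrite skips_shift // -d2; case: eqP => [eq_n|]; last by rewrite addn0.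
by have := ltn_ord d.2; rewrite -eq_n ltnn.
Qed.

Lemma fits_unshift (b : nat -> bool) j : fits b -> ~~ b j -> b j.+1 -> fits (unshift_bit b j).
Proof.
move=> fits_b bj bj1.
have skE x := skips_shift (b := unshift_bit b j) (j := j) x.
have u1 : unshift_bit b j j by rewrite /unshift_bit eqxx.
have u2 : ~~ unshift_bit b j j.+1 by rewrite /unshift_bit eqxx; case: eqP; lia.
have {}skE x : skips b x = skips (unshift_bit b j) x + (x == j.+1).
  by rewrite -skE // (eq_skips (unshift_bitK bj bj1)).
move=> x; rewrite {1}/unshift_bit; case: eqVneq => [-> _|ne_x].
  (* The pebble goes back up the diagonal from a cell of [la], so it stays in [la]. *)
  have := fits_b _ bj1; rewrite skE eqxx addn1 skipsS u1 addn0.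
  by move/ltnW/leq_trans; apply; apply: part_mono.
by case: eqVneq => // ne_x1 /fits_b; rewrite skE (negbTE ne_x1) addn0.
Qed.

Lemma excitation_unstep (b : nat -> bool) j : fits b -> ~~ b j -> b j.+1 ->
  excitation_move (placed (unshift_bit b j)) (placed b).
Proof.
move=> fits_b bj bj1; set b' := unshift_bit b j.
have fits_b' : fits b' by apply: fits_unshift.
have bK : shift_bit b' j =1 b by apply: unshift_bitK.
have u1 : b' j by rewrite /b' /unshift_bit eqxx.
have u2 : ~~ b' j.+1 by rewrite /b' /unshift_bit eqxx; case: eqP; lia.
case: (fits_cell fits_b' u1) => c Dc [c1 c2].
case: (fits_cell fits_b bj1) => d; rewrite inE => /andP[_ /eqP d1'] [d1 d2].
have {}d1 : d.1 = c.1.+1 :> nat.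
  by rewrite d1 -(eq_skips bK) skips_shift // eqxx addn1 skipsS u1 addn0 c1.
have {}d2 : d.2 = c.2.+1 :> nat by rewrite d2 c2.
apply/exists_inP; exists c => //; apply/exists_inP; exists d.
  by rewrite inE d1' d2 c2; apply: fits_b.
rewrite d1 d2 !eqxx /=; apply/andP; split.
  rewrite !inE /= d1 d2 c2 (negbTE u2) /= u1 /= -c1.
  by rewrite andbT neq_ltn ltnSn orbT.
by rewrite -(placed_shift d1 d2 Dc) ?c2 // (eq_placed bK).
Qed.

(** Descent on the sum of the rows [skips b x]: an unchosen column followed by a chosen one allows
    an excitation to be undone, which lowers the sum by one. If there is no such pair, the diagram
    is the initial one. *)
Lemma fits_excited b m : fits b -> skips b n + m = n ->
  connect (@excitation_move la) (initial_diagram la (row_partition m)) (placed b).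
Proof.
move=> + + ; have [N] := ubnP (\sum_(x < n) skips b x).
elim: N b => // N IHN b leN fits_b skb.
case: (pickP (fun j : 'I_n => ~~ b j && b j.+1)) => [j /andP[bj bj1]|nob].
  apply: connect_trans (connect1 (excitation_unstep fits_b bj bj1)).
  set b' := unshift_bit b j.
  have u1 : b' j by rewrite /b' /unshift_bit eqxx.
  have u2 : ~~ b' j.+1 by rewrite /b' /unshift_bit eqxx; case: eqP; lia.
  have skE x : skips b x = skips b' x + (x == j.+1).
    by rewrite -skips_shift // (eq_skips (unshift_bitK bj bj1)).
  have lt_j1 := fits_lt fits_b bj1.
  apply: IHN; last 1 first.
  - by rewrite -[RHS]skb skE; case: eqP; lia.
  - rewrite -ltnS; apply: leq_trans leN; rewrite ltnS [leqRHS](bigD1 (Ordinal lt_j1)) //=.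
    rewrite (bigD1 (Ordinal lt_j1)) //= [in leqRHS]skE eqxx addn1 addSn ltnS.
    by rewrite leq_add2l; apply: leq_sum => x _; rewrite skE leq_addr.
  - exact: fits_unshift.
have ex_k : exists k, ~~ b k.
  by exists n; apply/negP=> /(fits_lt fits_b); rewrite ltnn.
(* With no step from unchosen to chosen, the chosen columns are those before the first unchosen
   column [k]; counting them gives [k = m]. *)
case: (ex_minnP ex_k) => k bk min_k.
have eq_b : b =1 (fun x => x < k).
  move=> x; case: ltnP => [lt_x|].
    by apply: contraTT lt_x => /min_k; rewrite -leqNgt.
  elim: x => [|x IHx]; first by rewrite leqn0 => /eqP <-; apply: negbTE.
  rewrite leq_eqVlt => /predU1P[<-|]; first exact: negbTE.
  move/IHx=> bx; apply/negP=> bx1; have lt_x := ltnW (fits_lt fits_b bx1).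
  by have := nob (Ordinal lt_x); rewrite /= bx bx1.
have le_k : k <= n by apply: min_k; apply/negP=> /(fits_lt fits_b); rewrite ltnn.
have <- : k = m by move: skb; rewrite (eq_skips eq_b) skips_ltn; lia.
by rewrite initial_placed (eq_placed eq_b).
Qed.

Lemma excited_fits m D : m <= n ->
  D \in excited_diagrams la (row_partition m) ->
  exists b, [/\ fits b, skips b n + m = n & D = placed b].
Proof.
move=> le_m; rewrite inE => /connectP[p].
have : exists b, [/\ fits b, skips b n + m = n &
    initial_diagram la (row_partition m) = placed b].
  exists (fun x => x < m); split; first exact: fits_ltn.
    by rewrite skips_ltn subnK.
  exact: initial_placed.
elim: p (initial_diagram _ _) => [|D1 p IHp] D0 [b [fits_b skb ->]] /=.
  by move=> _ ->; exists b.
case/andP=> /(excitation_step fits_b)[b' [fits_b' skb' eqD1]] pathp eqD.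
by apply: (IHp D1) => //; exists b'; rewrite skb'.
Qed.

Lemma placed_prod b : fits b ->
  \prod_(c in placed b) hook_length c
    = \prod_(j < n | b j) hooklen la (skips b j) j.
Proof.
move=> fits_b.
rewrite (eq_bigr (fun c : cell la => hooklen la c.1 c.2)); last first.
  move=> c; rewrite inE => /andP[bc /eqP c1].
  by rewrite hook_lengthE // inE c1 fits_b.
rewrite (eq_bigl (fun c : cell la => b c.2 && (c.1 == skips b c.2 :> nat))); last first.
  by move=> c; rewrite inE.
pose F (i : 'I_(size la)) (j : 'I_n) := hooklen la i j.
pose Q (j : 'I_n) (i : 'I_(size la)) := i == skips b j :> nat.
have -> : \prod_(c : cell la | b c.2 && Q c.2 c.1) F c.1 c.2
        = \prod_(i < size la) \prod_(j < n | b j && Q j i) F i j.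
  by rewrite pair_big_dep; apply: eq_bigl.
rewrite (exchange_big_dep (fun j : 'I_n => b j)) /=; last by move=> i j _ /andP[].
apply: eq_bigr => j bj.
rewrite (big_pred1 (Ordinal (part_size (fits_b j bj)))) // => i.
by rewrite bj.
Qed.

(** The sum may run over all words with [m] chosen columns: a word that does not fit has a pebble
    outside [la], where [hooklen] is 0, so its product vanishes. *)
Lemma E_words m : m <= n ->
  E m la = \sum_(s : n.-tuple bool | skips (nth false s) n + m == n)
             \prod_(j < n | nth false s j) hooklen la (skips (nth false s) j) j.
Proof.
move=> le_m; rewrite /E subpartition_row le_m /excitation_factor.
pose fitsb (s : n.-tuple bool) :=
  [forall j : 'I_n, nth false s j ==> (j < part la (skips (nth false s) j))].
have fitsP (s : n.-tuple bool) : reflect (fits (nth false s)) (fitsb s).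
  apply: (iffP forallP) => [fits_s j sj|fits_s j]; last exact/implyP/fits_s.
  case: (ltnP j n) => [lt_j|le_j]; last by rewrite nth_default ?size_tuple in sj.
  by have := fits_s (Ordinal lt_j); rewrite /= sj.
pose A := [set s : n.-tuple bool | fitsb s && (skips (nth false s) n + m == n)].
have -> : excited_diagrams la (row_partition m)
        = [set placed (nth false s) | s : n.-tuple bool in A].
  apply/setP=> D; apply/idP/imsetP => [/(excited_fits le_m)|].
    case=> b [fits_b skb ->]; pose s := [tuple b j | j < n].
    have eq_s : b =1 nth false s.
      move=> j; case: (ltnP j n) => [lt_j|le_j].
        by have := nth_mktuple (fun j : 'I_n => b j) false (Ordinal lt_j).
      rewrite nth_default ?size_tuple //.
      by apply/negP=> /(fits_lt fits_b); rewrite ltnNge le_j.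
    exists s; last exact: eq_placed.
    rewrite inE -(eq_skips eq_s) skb eqxx andbT.
    exact/fitsP/(eq_fits eq_s).
  case=> s; rewrite inE => /andP[/fitsP fits_s /eqP sks] ->.
  by rewrite inE; apply: fits_excited.
rewrite big_imset /=; last first.
  move=> s s'; rewrite !inE => /andP[/fitsP fits_s _] /andP[/fitsP fits_s' _].
  move/(placed_inj fits_s fits_s') => eq_s.
  by apply/val_inj/(@eq_from_nth _ false) => [|j _]; rewrite ?size_tuple.
rewrite [RHS](bigID fitsb) /= [X in _ + X]big1 ?addn0; last first.
  move=> s /andP[_]; rewrite negb_forall => /existsP[j].
  rewrite negb_imply -leqNgt => /andP[sj le_j].
  by apply/eqP; rewrite (bigD1 j) //= hooklen_out.
apply: eq_big => [s|s]; first by rewrite inE andbC.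
by rewrite inE => /andP[/fitsP fits_s _]; apply: placed_prod.
Qed.

End Excited.

(** * Weighted sums over words *)

Import GRing.Theory.
Local Open Scope ring_scope.

(** [j - skips b j] counts the chosen columns before [j], so it takes the values 0, 1, 2, ... in
    order as [j] runs through the chosen columns. *)
Lemma prod_chosen (R : comPzSemiRingType) (b : nat -> bool) (g : nat -> R) N :
  \prod_(j < N | b j) g (j - skips b j)%N = \prod_(k < N - skips b N) g k.
Proof.
elim: N => [|N IHN]; first by rewrite !big_ord0.
rewrite big_mkcond big_ord_recr -big_mkcond /= IHN skipsS.
case: (b N) => /=; last by rewrite mulr1 addn1 subSS.
by rewrite addn0 (subSn (skips_le b N)) big_ord_recr.
Qed.

Lemma sum_tupleS (V : nmodType) N (F : seq bool -> V) :
  \sum_(s : N.+1.-tuple bool) F s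
    = \sum_(s : N.-tuple bool) F (true :: s) + \sum_(s : N.-tuple bool) F (false :: s).
Proof.
pose cons_bool (p : bool * N.-tuple bool) := [tuple of p.1 :: p.2].
rewrite (reindex cons_bool) /=; last first.
  exists (fun t => (thead t, [tuple of behead t])) => [[b s] _|t _].
    by congr (_, _); apply/val_inj.
  by rewrite [RHS]tuple_eta; apply/val_inj.
rewrite -(pair_big xpredT xpredT (fun b (s : N.-tuple bool) => F (b :: s))) /=.
by rewrite big_bool.
Qed.

(** The sum over lattice paths of [N] steps from [(i, c)]: a true bit is a horizontal step of weight
    [f], a false bit a diagonal step of weight 1. *)
Definition word_sum (R : comPzSemiRingType) (f : nat -> nat -> R) (N i c : nat) : R :=
  \sum_(s : N.-tuple bool)
    \prod_(j < N | nth false s j) f (i + skips (nth false s) j)%N (c + j)%N.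

Lemma word_sum0 (R : comPzSemiRingType) (f : nat -> nat -> R) i c :
  word_sum f 0 i c = 1.
Proof.
rewrite /word_sum (big_pred1 [tuple]) => [|s]; first by rewrite big_ord0.
by rewrite [s]tuple0 /= eqxx.
Qed.

Lemma word_sumS (R : comPzSemiRingType) (f : nat -> nat -> R) N i c :
  word_sum f N.+1 i c = f i c * word_sum f N i c.+1 + word_sum f N i.+1 c.+1.
Proof.
rewrite /word_sum (sum_tupleS N (fun s => \prod_(j < N.+1 | nth false s j)
   f (i + skips (nth false s) j)%N (c + j)%N)) big_distrr /=.
congr (_ + _); apply: eq_bigr => s _.
  rewrite big_mkcond big_ord_recl /= skips0 !addn0 [in RHS]big_mkcond /=.
  by congr (_ * _); apply: eq_bigr => j _; rewrite skips_cons add0n addSnnS.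
rewrite big_mkcond big_ord_recl /= mul1r [in RHS]big_mkcond /=.
apply: eq_bigr => j _; rewrite skips_cons.
by congr (if _ then f _ _ else 1); rewrite ?addnA ?addn1.
Qed.

(** * The generating function and its product formula *)

Section GeneratingFunction.

Variables (K : fieldType) (u : K).
Hypothesis u_generic : forall i c : nat, u + i%:R - c%:R != 0.
Variable la : intpart.
Local Notation n := (part la 0).

Let weight i c : K := (hooklen la i c)%:R / (u + i%:R - c%:R).

(** Induction on the number of remaining columns, splitting off the first step of the path. *)
Lemma word_sumE N i c : (N + c = n)%N ->
  word_sum weight N i c = \prod_(i <= t < colen la c)
     ((u + t.+1%:R - c%:R) / (u + t.+1%:R - (part la t)%:R)).
Proof.
elim: N i c => [|N IHN] i c eq_n.
  rewrite word_sum0 big_geq // leqNgt -part_gt -leqNgt.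
  by apply: leq_trans (part_mono _ (leq0n i)) _; rewrite -eq_n.
rewrite word_sumS !IHN ?addnS //.
(* The product for column [c.+1] can be extended to the length of column [c]: the added rows have
   [part la t = c.+1], so their factors are 1. *)
have drop_col k : \prod_(k <= t < colen la c.+1)
      ((u + t.+1%:R - c.+1%:R) / (u + t.+1%:R - (part la t)%:R))
    = \prod_(k <= t < colen la c) ((u + t%:R - c%:R) / (u + t.+1%:R - (part la t)%:R)).
  have le_col : (colen la c.+1 <= colen la c)%N.
    by apply: sub_count => x /= /ltnW.
  rewrite (big_nat_widen _ _ _ _ _ le_col) big_mkcond /=.
  apply: eq_big_nat => t /andP[_ lt_t]; rewrite -part_gt; case: ltnP => [_|ge_t].
    by congr (_ / _); rewrite -!natr1; ring.
  rewrite -part_gt in lt_t.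
  have -> : part la t = c.+1 by apply/eqP; rewrite eqn_leq ge_t.
  have -> : u + t.+1%:R - c.+1%:R = u + t%:R - c%:R by rewrite -!natr1; ring.
  by rewrite divff.
rewrite !drop_col /weight.
case: (ltnP i (colen la c)) => [lt_i|ge_i]; last first.
  rewrite hooklen_out; last by rewrite leqNgt part_gt -leqNgt.
  by rewrite !big_geq ?mul0r ?add0r // ltnW.
have la_ic : (c < part la i)%N by rewrite part_gt.
rewrite /hooklen; case: (colen la c) lt_i => // l; rewrite ltnS => le_il.
rewrite subSS natrD !natrB ?(ltnW la_ic) // !prodf_div.
rewrite [\prod_(i <= t < l.+1) (u + t%:R - c%:R)]big_nat_recl //.
rewrite ![\prod_(i <= t < l.+1) (u + t.+1%:R - (part la t)%:R)]big_nat_recl //.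
rewrite [\prod_(i <= t < l.+1) (u + t.+1%:R - c%:R)]big_nat_recr //= !big_add1 /=.
(* Up to the common factor [Q / D], the recurrence reduces to
   [h + (u + i + 1 - la_i) = u + l + 1 - c], where [h = (la_i - c) + (l - i)] is the hook length. *)
set Q := \prod_(i <= t < l) (u + t.+1%:R - c%:R).
set D := \prod_(i <= t < l) _.
have D0 : D != 0 by rewrite prodf_seq_neq0; apply/allP => t _; apply: u_generic.
have := u_generic i c; have := u_generic i.+1 (part la i).
rewrite -!natr1 => nz1 nz2; field.
by rewrite D0 nz1 nz2.
Qed.

Lemma E_genfun M : (n <= M)%N ->
  \sum_(m < M.+1) (E m la)%:R / \prod_(k < m) (u - k%:R)
    = \prod_(0 <= t < colen la 0) ((u + t.+1%:R) / (u + t.+1%:R - (part la t)%:R)).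
Proof.
move=> le_n; pose F m : K := (E m la)%:R / \prod_(k < m) (u - k%:R).
have -> : \sum_(m < M.+1) F m = \sum_(m < n.+1) F m.
  rewrite [RHS](big_ord_widen M.+1 F) // [RHS]big_mkcond; apply: eq_bigr => m _.
  by rewrite ltnS; case: leqP => // /E_gt; rewrite /F => ->; rewrite mul0r.
transitivity (word_sum weight n 0 0); last first.
  by rewrite word_sumE ?addn0 //; apply: eq_bigr => t _; rewrite subr0.
rewrite /word_sum.
(* Words are grouped by their number of chosen columns, which is at most [n], so [inord] does not
   truncate. *)
rewrite (partition_big (fun s : n.-tuple bool =>
   inord (n - skips (nth false s) n) : 'I_n.+1) xpredT) //=.
apply: eq_bigr => m _; rewrite /F E_words -1?ltnS // natr_sum mulr_suml.
apply: eq_big => [s|s /eqP sk].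
  rewrite -val_eqE /= inordK ?ltnS ?leq_subr //.
  have := skips_le (nth false s) n; have := ltn_ord m.
  move: (skips _ _) (nat_of_ord m) => k k' lt_k' le_k; apply/eqP/eqP; lia.
have -> : m = (n - skips (nth false s) n)%N :> nat.
  by apply/eqP; rewrite -(eqn_add2l (skips (nth false s) n)) sk subnKC ?skips_le.
(* A chosen column [j] has denominator [u - (j - skips j)]; over all chosen columns these make up
   the falling factorial. *)
rewrite -(prod_chosen _ (fun k => u - k%:R)) natr_prod -prodf_div.
apply: eq_bigr => j _; rewrite /weight !add0n natrB ?skips_le //.
by rewrite opprB addrA.
Qed.

(** Rows past the last part contribute factors 1. With [M] and [L] common to two partitions, the
    numerators agree and only the denominators depend on the partition. *)
Lemma E_genfun_ext M L : (n <= M)%N -> (colen la 0 <= L)%N ->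
  \sum_(m < M.+1) (E m la)%:R / \prod_(k < m) (u - k%:R)
    = \prod_(t < L) (u + t.+1%:R) / \prod_(t < L) (u + t.+1%:R - (part la t)%:R).
Proof.
move=> le_M le_L; rewrite E_genfun // -prodf_div.
rewrite (big_nat_widen _ _ _ _ _ le_L) big_mkcond big_mkord.
apply: eq_bigr => t _ /=; rewrite -part_gt; case: posnP => // ->.
by rewrite subr0 divff //; have := u_generic t.+1 0; rewrite subr0.
Qed.

End GeneratingFunction.

(** * Recovering the partition from the poles *)

Theorem theorem4p1 (la la' : intpart) :
  (forall m : nat, E m la = E m la') -> la = la'.
Proof.
(* Taking [u] to be an indeterminate over the integers makes every [u + i - c] nonzero. *)
move=> eqE; pose u : {fraction {poly int}} := tofrac 'X.
have u_generic (i c : nat) : u + i%:R - c%:R != 0.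
  have -> : u + i%:R - c%:R = tofrac ('X - (c%:R - i%:R)%:P).
    by rewrite /u polyCB !polyC_natr !tofracB !tofracMn tofrac1 opprB addrA.
  by rewrite tofrac_eq0 polyXsubC_eq0.
pose M := maxn (part la 0) (part la' 0).
pose L := maxn (colen la 0) (colen la' 0).
(* The roots of the denominator as a polynomial in [u]. *)
pose a (mu : intpart) := mkseq (fun t => (part mu t)%:R - t.+1%:R : int) L.
have denE (mu : intpart) : \prod_(t < L) (u + t.+1%:R - (part mu t)%:R)
    = tofrac (\prod_(x <- a mu) ('X - x%:P)).
  rewrite big_map -[in iota 0 L](subn0 L) -/(index_iota 0 L) big_mkord rmorph_prod /=.
  apply: eq_bigr => t _ /=.
  by rewrite /u polyCB !polyC_natr !tofracB !tofracMn tofrac1 opprB addrA.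
have num0 : \prod_(t < L) (u + t.+1%:R) != 0.
  apply/prodf_neq0 => t _; have := u_generic t.+1 0.
  by rewrite subr0.
have : \prod_(x <- a la) ('X - x%:P) = \prod_(x <- a la') ('X - x%:P).
  apply/eqP; rewrite -tofrac_eq -!denE; apply/eqP/invr_inj/(mulfI num0).
  rewrite -!(E_genfun_ext u_generic (M := M)) ?leq_maxl ?leq_maxr //.
  by apply: eq_bigr => m _; rewrite eqE.
move=> eq_prod.
(* The parts weakly decrease, so the numbers [part mu t - (t + 1)] strictly decrease; the set of
   roots alone then determines the list. *)
have a_sorted mu : sorted (fun x y => y < x) (a mu).
  apply: (homo_sorted (e := ltn)) (iota_ltn_sorted 0 L) => s t lt_st.
  have := part_mono mu (ltnW lt_st).
  lia.
have eq_a : a la = a la'.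
  apply: irr_sorted_eq (a_sorted la) (a_sorted la') _.
  - by move=> x y z /= lt_xy lt_zx; apply: Order.POrderTheory.lt_trans lt_xy.
  - exact: Order.POrderTheory.ltxx.
  by move=> x; rewrite -!root_prod_XsubC eq_prod.
apply: eq_part => t; case: (ltnP t L) => [lt_t|].
  have := congr1 (nth 0 ^~ t) eq_a; rewrite !nth_mkseq //.
  lia.
rewrite geq_max => /andP[].
by rewrite ![(colen _ _ <= t)%N]leqNgt -!part_gt -!eqn0Ngt => /eqP -> /eqP ->.
Qed.
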